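(* Let $M,N\ge 1$ and let $A_1,\dots,A_N$ be $\mathfrak{sl}(M,\mathbb{C})$-valued holomorphic functions of $(\lambda_1,\dots,\lambda_N)$ on an open subset of $\{(\lambda_1,\dots,\lambda_N)\in\mathbb{C}^N:\lambda_i\neq\lambda_j \text{ for } i\neq j\}$ which satisfy the Schlesinger system $$\frac{\partial A_j}{\partial\lambda_i}=\frac{[A_j,A_i]}{\lambda_j-\lambda_i}\quad(i\neq j),\qquad \frac{\partial A_j}{\partial\lambda_j}=-\sum_{i\neq j}\frac{[A_j,A_i]}{\lambda_j-\lambda_i},$$ together with $\sum_{j=1}^N A_j=0$. For integers $n\ge 0$ set $\mathcal{B}_n:=\sum_{j=1}^N\lambda_j^n A_j$, and for integers $m\ge -1$ set $L_m:=\sum_{j=1}^N\lambda_j^{m+1}\frac{\partial}{\partial\lambda_j}$. Then for all $m=-1,0,1,2,\dots$ and all $n=1,2,\dots$, $$L_m\mathcal{B}_n=\sum_{k=1}^{n-1}[\mathcal{B}_k,\mathcal{B}_{m+n-k}]+n\,\mathcal{B}_{m+n}.$$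
   Context: $[X,Y]=XY-YX$ is the matrix commutator. Differential operators act entrywise on matrix-valued functions. An empty sum is zero. *)

(* Defs.v *)
(* MathComp / MathComp-Analysis. *)
From mathcomp Require Import all_boot all_order all_algebra complex.
From mathcomp Require Import all_classical all_reals all_analysis.

Set Implicit Arguments.
Unset Strict Implicit.
Unset Printing Implicit Defensive.

Import Order.TTheory GRing.Theory Num.Theory.
Import numFieldNormedType.Exports.

Local Open Scope classical_set_scope.
Local Open Scope ring_scope.

(* The complex numbers over a model R of the reals.  The target numFieldType
   is what equips Cplx R, row vectors and matrices over it with the complex
   normed-module structures used by [differentiable] and ['D_v]. *)
Definition Cplx (R : realType) : numFieldType := R[i].

Section Schlesinger.
Context {K : numFieldType} {M N : nat}.
Implicit Types (X Y : 'M[K]_M) (F : 'rV[K]_N -> 'M[K]_M).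
Implicit Types (A : 'I_N -> 'rV[K]_N -> 'M[K]_M).
Implicit Types (U : set 'rV[K]_N) (lam : 'rV[K]_N).

Definition commutator X Y : 'M[K]_M := X *m Y - Y *m X.

Definition config_space : set 'rV[K]_N :=
  [set lam | forall i j : 'I_N, i != j -> lam ord0 i != lam ord0 j].

(* For K = Cplx R, Frechet differentiability over K at every point of an open
   set U is holomorphy in several complex variables. *)
Definition holomorphic_on U F : Prop :=
  forall lam, U lam -> forall a b, differentiable (fun x => F x a b) lam.

Definition partial (i : 'I_N) F lam : 'M[K]_M :=
  \matrix_(a, b) 'D_(delta_mx ord0 i) (fun x => F x a b) lam.

Definition schlesinger_system U A : Prop :=
  forall lam, U lam ->
    (forall i j, i != j ->
       partial i (A j) lam =
       (lam ord0 j - lam ord0 i)^-1 *: commutator (A j lam) (A i lam))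
    /\
    (forall j,
       partial j (A j) lam =
       - \sum_(i < N | i != j)
           (lam ord0 j - lam ord0 i)^-1 *: commutator (A j lam) (A i lam)).

(* Indexed by int so that indices such as m + n - k with m = -1 need no
   truncation; only the values at n >= 0 are meaningful. *)
Definition Bn A (n : int) lam : 'M[K]_M :=
  \sum_(j < N) lam ord0 j ^ n *: A j lam.

(* Only meaningful for m >= -1. *)
Definition Lm (m : int) F lam : 'M[K]_M :=
  \sum_(j < N) lam ord0 j ^ (m + 1) *: partial j F lam.

End Schlesinger.

(* Main.v *)
(* Write c l j := [A_l, A_j] / (lambda_l - lambda_j), which is symmetric in
   l and j.  Differentiating the factors lambda_j ^ n gives n B_(m+n); by the
   Schlesinger equations and the symmetry of c, the derivatives of the A_l
   contribute the sum over l, j of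
   lambda_j ^ (m+1) * (lambda_l ^ n - lambda_j ^ n) * c l j.
   The denominator divides the difference of powers, and the geometric sum
   yields the commutators [B_k, B_(m+n-k)] for 0 <= k < n, of which the one
   with k = 0 vanishes because B_0 = 0. *)
Require Import Defs.
From HB Require Import structures.
From mathcomp Require Import zify.
From mathcomp Require Import all_boot all_order all_algebra complex.
From mathcomp Require Import all_classical all_reals all_analysis.

Set Implicit Arguments.
Unset Strict Implicit.
Unset Printing Implicit Defensive.

Import Order.TTheory GRing.Theory Num.Theory.
Import numFieldNormedType.Exports.

Local Open Scope classical_set_scope.
Local Open Scope ring_scope.

Section Schlesinger.
Context {K : numFieldType} {M N : nat}.
Implicit Types (X : 'I_N -> 'M[K]_M) (A : 'I_N -> 'rV[K]_N -> 'M[K]_M).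
Implicit Types (U : set 'rV[K]_N) (lam : 'rV[K]_N).

Lemma commutatorvv (Y : 'M[K]_M) : commutator Y Y = 0.
Proof. exact: subrr. Qed.

Lemma commutatorC (Y Z : 'M[K]_M) : commutator Y Z = - commutator Z Y.
Proof. by rewrite opprB. Qed.

Lemma commutator0l (Y : 'M[K]_M) : commutator 0 Y = 0.
Proof. by rewrite /commutator mul0mx mulmx0 subrr. Qed.

Lemma commutator_lincomb (a b : 'I_N -> K) X :
  commutator (\sum_l a l *: X l) (\sum_j b j *: X j) =
  \sum_j \sum_l (b j * a l) *: commutator (X l) (X j).
Proof.
rewrite /commutator !mulmx_suml.
under eq_bigr do rewrite mulmx_sumr.
rewrite exchange_big /=.
under [in X in _ - X]eq_bigr do rewrite mulmx_sumr.
rewrite -sumrB; apply: eq_bigr => j _; rewrite -sumrB; apply: eq_bigr => l _.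
by rewrite -!scalemxAl -!scalemxAr !scalerA scalerBr [a l * _]mulrC.
Qed.

(* The junk value 0^-1 = 0 is harmless on the diagonal, where the commutator
   vanishes; hence no side conditions l != j in the sums below. *)
Definition schlesinger_term (x : 'I_N -> K) X (l j : 'I_N) : 'M[K]_M :=
  (x l - x j)^-1 *: commutator (X l) (X j).

Lemma schlesinger_termC x X l j :
  schlesinger_term x X l j = schlesinger_term x X j l.
Proof.
by rewrite /schlesinger_term commutatorC -(opprB (x j)) invrN scaleNr scalerN opprK.
Qed.

Lemma schlesinger_term_diag x X l : schlesinger_term x X l l = 0.
Proof. by rewrite /schlesinger_term commutatorvv scaler0. Qed.

(** Off the diagonal, [subrXX] provides the factor [x l - x j] that cancels the denominator; on it,
    both sides vanish. *)
Lemma subX_schlesinger_term (x : 'I_N -> K) X (n : nat) l j :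
  (l != j -> x l != x j) ->
  (x l ^+ n - x j ^+ n) *: schlesinger_term x X l j =
  \sum_(k < n) (x l ^+ (n.-1 - k) * x j ^+ k) *: commutator (X l) (X j).
Proof.
move=> xlj; have [->|/xlj neq] := eqVneq l j.
  by rewrite schlesinger_term_diag commutatorvv scaler0 big1 // => k _;
    rewrite scaler0.
rewrite scalerA subrXX mulrAC divff ?subr_eq0 // mul1r.
by rewrite scaler_suml.
Qed.

(** The algebraic core, at a fixed point: with [x] the coordinates and [X] the values of the [A l],
    the bracket is the derivative of [A l] in direction [j], both Schlesinger equations being merged
    into one formula. *)
Lemma sum_schlesinger (x : 'I_N -> K) X (p n : nat) : injective x ->
  \sum_j x j ^+ p *: \sum_l x l ^+ n *:
    (schlesinger_term x X l j
     - (\sum_i schlesinger_term x X l i) *+ (l == j)) =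
  \sum_(k < n) commutator (\sum_l x l ^+ k *: X l)
                           (\sum_j x j ^+ (p + n.-1 - k) *: X j).
Proof.
move=> xinj.
transitivity (\sum_j \sum_l \sum_(k < n)
  (x j ^+ (p + k) * x l ^+ (n.-1 - k)) *: commutator (X l) (X j)).
  apply: eq_bigr => j _.
  (* The diagonal part of the bracket only survives at [l = j]; by symmetry its sum runs over the
     same terms as the off-diagonal part, with weight [- x j ^+ n]. *)
  transitivity (x j ^+ p *: \sum_l
      (x l ^+ n - x j ^+ n) *: schlesinger_term x X l j).
    congr (_ *: _); under eq_bigr do rewrite scalerBr.
    rewrite sumrB (bigD1 j (F := fun i => x i ^+ n *: (_ *+ (i == j)))) //=.
    rewrite eqxx mulr1n [X in _ - (_ + X)]big1 ?addr0; last first.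
      by move=> i /negPf ->; rewrite mulr0n scaler0.
    rewrite scaler_sumr -sumrB; apply: eq_bigr => l _.
    by rewrite scalerBl [schlesinger_term x X j l]schlesinger_termC.
  rewrite scaler_sumr; apply: eq_bigr => l _.
  rewrite subX_schlesinger_term; last by rewrite (inj_eq xinj).
  rewrite scaler_sumr; apply: eq_bigr => k _.
  by rewrite scalerA exprD -mulrA [x l ^+ _ * _]mulrC.
under eq_bigr do rewrite exchange_big /=.
(* Reversing [k] to [n.-1 - k] on the right matches the exponents of the geometric sum. *)
rewrite exchange_big /= [RHS](reindex_inj rev_ord_inj) /=.
apply: eq_bigr => k _; rewrite commutator_lincomb.
apply: eq_bigr => j _; apply: eq_bigr => l _.
by congr ((_ ^+ _ * _ ^+ _) *: _); have := ltn_ord k; lia.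
Qed.

Lemma is_derive_coord (j : 'I_N) lam (v : 'rV[K]_N) :
  is_derive lam v (fun x : 'rV[K]_N => x ord0 j : K) (v ord0 j).
Proof.
(* Packed as a continuous linear map, the coordinate is its own differential. *)
have lf : linear (fun x : 'rV[K]_N => x ord0 j : K^o).
  by move=> a y z; rewrite !mxE.
pose f := GRing.isLinear.Build _ _ _ _ _ lf.
pose g : {linear _ -> _} := HB.pack (fun x : 'rV[K]_N => x ord0 j : K^o) f.
have dg : differentiable g lam by exact: differentiable_coord.
apply: DeriveDef; first exact: diff_derivable.
rewrite (deriveE _ dg) (@diff_lin _ _ _ g) //.
exact: coord_continuous.
Qed.

(** Leibniz rule: among the power factors only that of index [i] has a nonzero derivative. At
    [n = 0] the truncated [n.-1] is harmless, since [*+ n] kills the term. *)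
Lemma partial_Bn A (n : nat) i lam :
  (forall j a b, differentiable (fun x => A j x a b) lam) ->
  partial i (Bn A n%:Z) lam =
  (lam ord0 i ^+ n.-1 *: A i lam) *+ n
  + \sum_j lam ord0 j ^+ n *: partial i (A j) lam.
Proof.
move=> dA; apply/matrixP => a b; rewrite !mxE.
have -> : (fun x => Bn A n%:Z x a b) =
  \sum_j ((fun x : 'rV[K]_N => x ord0 j : K) ^+ n * (fun x => A j x a b)).
  apply/funext => x; rewrite /Bn summxE fct_sumE; apply: eq_bigr => j _.
  by rewrite mxE mulrfctE exprfctE.
have dj j : is_derive lam (delta_mx ord0 i)
   ((fun x : 'rV[K]_N => x ord0 j : K) ^+ n * (fun x => A j x a b))
   (lam ord0 j ^+ n * partial i (A j) lam a b
    + A j lam a b * ((lam ord0 j ^+ n.-1 *+ (j == i)) *+ n)).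
  have dcoord := is_derive_coord j lam (delta_mx ord0 i).
  have dAj := derivableP (diff_derivable (v := delta_mx ord0 i) (dA j a b)).
  apply: is_derive_eq.
  rewrite !mxE eqxx /= exprfctE; congr (_ + _ * _).
  case: (j == i); first by rewrite mulr1n /GRing.scale /= mulr1 mulr_natl.
  by rewrite mulr0n mul0rn scaler0.
rewrite derive_sum; last by move=> j; have [] := dj j.
rewrite (eq_bigr _ (fun j _ => derive_val (is_derive := dj j))).
rewrite big_split /= addrC; congr (_ + _).
  rewrite (bigD1 i) //= eqxx mulr1n big1 ?addr0; last first.
    by move=> j /negPf ->; rewrite mul0rn mulr0.
  by rewrite mulmxnE mxE mulrnAr mulrC.
by rewrite summxE; apply: eq_bigr => j _; rewrite !mxE.
Qed.

(** Setting [p = m + 1] keeps all exponents natural. The commutator with [k = 0] is still present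
    here. *)
Lemma Lm_Bn A U (p n : nat) lam : U `<=` config_space ->
  (forall j, holomorphic_on U (A j)) -> schlesinger_system U A ->
  U lam ->
  Lm (p%:Z - 1) (Bn A n%:Z) lam =
  \sum_(k < n) commutator (Bn A k%:Z lam) (Bn A (p + n.-1 - k)%N%:Z lam)
  + Bn A (p + n.-1)%N%:Z lam *+ n.
Proof.
move=> Uconf Ahol Asch Ulam; pose x i := lam ord0 i; pose X i := A i lam.
have xinj : injective x.
  by move=> i j /eqP xij; apply/eqP; apply: contraLR xij; exact: Uconf.
(* For [j = i] the leading term is zero, and the full sum over [l] agrees with the punctured one
   because its diagonal summand vanishes. *)
have partialA i j : partial i (A j) lam = schlesinger_term x X j i
    - (\sum_l schlesinger_term x X j l) *+ (j == i).
  have [Aneq Aeq] := Asch _ Ulam.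
  have [->|neq] := eqVneq j i; last by rewrite subr0 Aneq 1?eq_sym.
  rewrite Aeq schlesinger_term_diag sub0r mulr1n [in RHS](bigD1 i) //=.
  by rewrite schlesinger_term_diag add0r.
rewrite /Lm subrK -(sum_schlesinger _ _ _ xinj).
have dA j a b : differentiable (fun x => A j x a b) lam by exact: Ahol.
under eq_bigr do rewrite (partial_Bn _ _ dA) scalerDr.
rewrite big_split /= addrC; congr (_ + _).
  apply: eq_bigr => i _; congr (_ *: _); apply: eq_bigr => j _.
  by rewrite partialA.
rewrite /Bn -sumrMnl; apply: eq_bigr => i _.
by rewrite -scalerMnr scalerA -exprD.
Qed.

Lemma Lm_Bn_sum0 A U (m : int) (n : nat) lam : U `<=` config_space ->
  (forall j, holomorphic_on U (A j)) -> schlesinger_system U A ->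
  (forall lam', U lam' -> \sum_(j < N) A j lam' = 0) ->
  -1 <= m -> (1 <= n)%N -> U lam ->
  Lm m (Bn A n%:Z) lam =
  \sum_(1 <= k < n) commutator (Bn A k%:Z lam) (Bn A (m + n%:Z - k%:Z) lam)
  + Bn A (m + n%:Z) lam *+ n.
Proof.
move=> Uconf Ahol Asch Asum0 m_ge n_ge Ulam.
have [p ->] : exists p : nat, m = p%:Z - 1.
  by exists (absz (m + 1)); rewrite gez0_abs ?addrK // -lerBlDr sub0r.
rewrite (Lm_Bn _ _ Uconf Ahol Asch Ulam).
case: n n_ge => // n _; rewrite /= big_ord_recl.
(* All weights are zeroth powers, so this is the sum of the residues [A j]. *)
have B0 : Bn A (nat_of_ord (@ord0 n))%:Z lam = 0.
  by rewrite /Bn -[RHS](Asum0 _ Ulam); apply: eq_bigr => j _; rewrite scale1r.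
rewrite B0 commutator0l add0r big_add1 big_mkord.
have -> : p%:Z - 1 + n.+1%:Z = (p + n)%N%:Z by lia.
congr (_ + _); apply: eq_bigr => k _.
(* Natural and integer subtraction agree, as the shifted index [k.+1] is at most [n], hence at most
   [p + n]. *)
by rewrite lift0 subzn // (leq_trans (ltn_ord k)) ?leq_addl.
Qed.

End Schlesinger.

Theorem theorem1 (R : realType) (M N : nat) (hM : (1 <= M)%N) (hN : (1 <= N)%N)
    (U : set 'rV[Cplx R]_N) (A : 'I_N -> 'rV[Cplx R]_N -> 'M[Cplx R]_M)
    (Uopen : open U) (Uconf : U `<=` config_space)
    (A_sl : forall j lam, U lam -> \tr (A j lam) = 0)
    (A_hol : forall j, holomorphic_on U (A j))
    (A_schlesinger : schlesinger_system U A)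
    (A_sum0 : forall lam, U lam -> \sum_(j < N) A j lam = 0) :
  forall (m : int) (n : nat), -1 <= m -> (1 <= n)%N ->
  forall lam, U lam ->
    Lm m (Bn A n%:Z) lam =
      \sum_(1 <= k < n)
        commutator (Bn A k%:Z lam) (Bn A (m + n%:Z - k%:Z) lam)
      + Bn A (m + n%:Z) lam *+ n.
Proof.
move=> m n m_ge n_ge lam Ulam.
exact: (Lm_Bn_sum0 Uconf A_hol A_schlesinger A_sum0 m_ge n_ge Ulam).
Qed.
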